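(* Szabo's metrizability theorem does not extend to general Finsler spacetimes: there exists a Finsler spacetime $(M,L)$ of Berwald type such that the Ricci tensor $$R_{ab}(x)=\partial_m\Gamma^m{}_{ab}-\partial_b\Gamma^m{}_{am}+\Gamma^m{}_{ms}\Gamma^s{}_{ab}-\Gamma^m{}_{bs}\Gamma^s{}_{am}$$ of the affine connection $\Gamma^a{}_{bc}(x)$ induced by $L$ on $M$ is not symmetric. Consequently, there is no pseudo-Riemannian metric on $M$ whose Levi--Civita connection is this affine connection.
   Context: Let $M$ be a smooth $n$-dimensional manifold and $TM$ its tangent bundle with induced local coordinates $(x^a,\dot x^a)$, where $\dot x=\dot x^a\partial_a\in T_xM$. Write $\partial_a=\partial/\partial x^a$ and $\dot\partial_a=\partial/\partial\dot x^a$. Smooth means $C^\infty$. Conic subbundle: a non-empty open submanifold $\mathcal{Q}\subset TM\setminus\{0\}$ such that $\pi(\mathcal{Q})=M$, where $\pi:TM\to M$ is the projection, and such that $(x,\dot x)\in\mathcal{Q}$ implies $(x,\lambda\dot x)\in\mathcal{Q}$ for all $\lambda>0$. Finsler spacetime: a pair $(M,L)$, where $L:\mathcal{A}\to\mathbb{R}$ is a smooth function on a conic subbundle $\mathcal{A}\subset TM$ such that: (i) $L(x,\lambda\dot x)=\lambda^2L(x,\dot x)$ for all $\lambda>0$; (ii) on $\mathcal{A}$ the $L$-metric $g^L_{ab}=\frac12\dot\partial_a\dot\partial_bL$ is nondegenerate; (iii) there is a conic subset $\mathcal{T}\subset\mathcal{A}$ on which $L>0$ and $g^L$ has Lorentzian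 signature $(+,-,\dots,-)$, and $L$ can be continuously extended to the boundary $\partial\mathcal{T}$ by $L|_{\partial\mathcal{T}}=0$. (Equivalently, one may use the opposite sign of $L$ and signature $(-,+,\dots,+)$.) Geodesic spray coefficients on $\mathcal{A}$: $G^a=\frac14 (g^L)^{aq}(\dot x^m\partial_m\dot\partial_qL-\partial_qL)$. Berwald type: $(M,L)$ is of Berwald type if $G^a(x,\dot x)=\frac12\Gamma^a{}_{bc}(x)\dot x^b\dot x^c$ with coefficients $\Gamma^a{}_{bc}(x)=\dot\partial_b\dot\partial_cG^a$ depending only on $x$. These are the coefficients of a torsion-free affine connection on $M$, the affine connection induced by $L$. Szabo's theorem (known, positive definite case): if $(M,F)$ is a Finsler space of Berwald type (with $F$ smooth on $TM\setminus\{0\}$ and positive definite Finsler metric), then there is a Riemannian metric on $M$ whose Levi--Civita connection is the affine connection of $(M,F)$. *)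

(* Defs.v *)
From HB Require Import structures.
From mathcomp Require Import all_boot all_order all_algebra.
From mathcomp Require Import all_classical all_reals all_analysis.

Set Implicit Arguments.
Unset Strict Implicit.
Unset Printing Implicit Defensive.

Import Order.TTheory GRing.Theory Num.Theory.
Import numFieldNormedType.Exports.

Local Open Scope classical_set_scope.
Local Open Scope ring_scope.

(* For U open and V finite dimensional this is the usual C^k: all directional
   derivatives exist on U and are C^(k-1).  It only depends on the values of f
   on the open set U. *)
Fixpoint Ck_on (R : realType) (V W : normedModType R) (k : nat) (U : set V)
    (f : V -> W) : Prop :=
  (forall x, U x -> {for x, continuous f}) /\
  match k with
  | 0 => True
  | k'.+1 => forall v : V,
      (forall x, U x -> derivable f x v) /\ Ck_on k' U (fun x => 'D_v f x)
  end.

Definition smooth_on (R : realType) (V W : normedModType R) (U : set V)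
  (f : V -> W) : Prop := forall k, Ck_on k U f.

(* An n-manifold with a smooth atlas.  The maps chart_map i and chart_inv i are
   total, but only their restrictions to chart_dom i and to its image matter.
   chart_at chooses a chart around each point; it makes the charts a cover and
   is used below to represent tangent spaces. *)
Record smoothManifold (R : realType) (n : nat) := SmoothManifold {
  carrier :> topologicalType;
  manifold_hausdorff : hausdorff_space carrier;
  manifold_second_countable : @second_countable carrier;
  chart_index : Type;
  chart_dom : chart_index -> set carrier;
  chart_map : chart_index -> carrier -> 'rV[R]_n;
  chart_inv : chart_index -> 'rV[R]_n -> carrier;
  chart_at : carrier -> chart_index;
  chart_atP : forall p, chart_dom (chart_at p) p;
  chart_dom_open : forall i, open (chart_dom i);
  chart_image_open : forall i, open (chart_map i @` chart_dom i);
  chart_mapK : forall i p, chart_dom i p -> chart_inv i (chart_map i p) = p;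
  chart_map_continuous : forall i p,
    chart_dom i p -> {for p, continuous (chart_map i)};
  chart_inv_continuous : forall i x,
    (chart_map i @` chart_dom i) x -> {for x, continuous (chart_inv i)};
  chart_transition_smooth : forall i j,
    smooth_on (chart_map i @` (chart_dom i `&` chart_dom j))
              (chart_map j \o chart_inv i)
}.

Definition chart_image (R : realType) (n : nat) (M : smoothManifold R n)
    (i : chart_index M) : set 'rV[R]_n :=
  chart_map i @` chart_dom i.

(* A tangent vector at p is represented by its components in the chosen chart
   chart_at p.  This is a record rather than a product so that it does not
   inherit the product topology, which is not the topology of TM. *)
Record tangent (R : realType) (n : nat) (M : smoothManifold R n) := Tangent {
  tbase : M;
  tcomp : 'rV[R]_n
}.

(* The tangent vector whose induced coordinates in chart i are
   z = (x, xdot): the components xdot are carried over to the chosen chart at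
   the base point by the differential of the transition map. *)
Definition tvec (R : realType) (n : nat) (M : smoothManifold R n)
    (i : chart_index M) (z : 'rV[R]_n * 'rV[R]_n) : tangent M :=
  let p := chart_inv i z.1 in
  Tangent p ('d (chart_map (chart_at p) \o chart_inv i) (z.1) (z.2)).

Definition tchart (R : realType) (n : nat) (M : smoothManifold R n)
    (i : chart_index M) : set ('rV[R]_n * 'rV[R]_n) :=
  [set z | chart_image i z.1].

(* The part of A over chart i, in induced coordinates. *)
Definition tset (R : realType) (n : nat) (M : smoothManifold R n)
    (A : set (tangent M)) (i : chart_index M) : set ('rV[R]_n * 'rV[R]_n) :=
  [set z | tchart i z /\ A (tvec i z)].

(* Openness for the manifold topology of TM. *)
Definition tangent_open (R : realType) (n : nat) (M : smoothManifold R n)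
    (A : set (tangent M)) : Prop :=
  forall i : chart_index M, open (tset A i).

Definition tscale (R : realType) (n : nat) (M : smoothManifold R n)
    (l : R) (t : tangent M) : tangent M := Tangent (tbase t) (l *: tcomp t).

Record conic_subbundle (R : realType) (n : nat) (M : smoothManifold R n)
    (Q : set (tangent M)) : Prop := ConicSubbundle {
  conic_nonempty : Q !=set0;
  conic_open : tangent_open Q;
  conic_slit : forall t, Q t -> tcomp t <> 0;
  conic_surj : @tbase R n M @` Q = setT;
  conic_scale : forall t (l : R), Q t -> 0 < l -> Q (tscale l t)
}.

(* Closure and boundary in TM of the part of T over chart i. *)
Definition tclosure (R : realType) (n : nat) (M : smoothManifold R n)
    (T : set (tangent M)) (i : chart_index M) : set ('rV[R]_n * 'rV[R]_n) :=
  closure (tset T i) `&` tchart i.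

Definition tboundary (R : realType) (n : nat) (M : smoothManifold R n)
    (T : set (tangent M)) (i : chart_index M) : set ('rV[R]_n * 'rV[R]_n) :=
  tclosure T i `\` interior (tset T i).

(* L restricted to T has a continuous extension to the closure of T in TM that
   vanishes on the boundary of T. *)
Definition extends_by_zero (R : realType) (n : nat) (M : smoothManifold R n)
    (T : set (tangent M)) (L : tangent M -> R) : Prop :=
  exists E : tangent M -> R,
    (forall t, T t -> E t = L t) /\
    (forall i : chart_index M,
      (forall z, tboundary T i z -> E (tvec i z) = 0) /\
      {within tclosure T i, continuous (E \o tvec i)}).

(* Partial derivatives of a function f (x, xdot) with respect to x^a and
   xdot^a. *)
Definition dx (R : realType) (n : nat) (a : 'I_n)
    (f : 'rV[R]_n * 'rV[R]_n -> R) (z : 'rV[R]_n * 'rV[R]_n) : R :=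
  'D_(delta_mx 0 a, 0) f z.

Definition dxdot (R : realType) (n : nat) (a : 'I_n)
    (f : 'rV[R]_n * 'rV[R]_n -> R) (z : 'rV[R]_n * 'rV[R]_n) : R :=
  'D_(0, delta_mx 0 a) f z.

Definition L_metric (R : realType) (n : nat)
    (f : 'rV[R]_n * 'rV[R]_n -> R) (z : 'rV[R]_n * 'rV[R]_n) : 'M[R]_n :=
  \matrix_(a, b) (2^-1 * dxdot a (dxdot b f) z).

(* Signature (+,-,...,-). *)
Definition lorentzian (R : realType) (n : nat) (g : 'M[R]_n) : Prop :=
  exists2 P : 'M[R]_n, P \in unitmx &
    P *m g *m P^T = diag_mx (\row_(j < n) (if val j == 0%N then 1 else -1)).

(* L is the Finsler function on A; its values outside A are irrelevant. *)
Record finsler_spacetime (R : realType) (n : nat) (M : smoothManifold R n)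
    (A : set (tangent M)) (L : tangent M -> R) : Prop := FinslerSpacetime {
  finsler_conic : conic_subbundle A;
  finsler_smooth : forall i : chart_index M,
    smooth_on (tset A i) (L \o tvec i);
  finsler_homogeneous : forall t (l : R),
    A t -> 0 < l -> L (tscale l t) = l ^+ 2 * L t;
  finsler_nondegenerate : forall (i : chart_index M) z,
    tset A i z -> L_metric (L \o tvec i) z \in unitmx;
  finsler_timelike : exists T : set (tangent M),
    [/\ conic_subbundle T, T `<=` A,
        forall t, T t -> 0 < L t,
        forall (i : chart_index M) z,
          tset T i z -> lorentzian (L_metric (L \o tvec i) z) &
        extends_by_zero T L]
}.

Definition spray (R : realType) (n : nat)
    (f : 'rV[R]_n * 'rV[R]_n -> R) (a : 'I_n) (z : 'rV[R]_n * 'rV[R]_n) : R :=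
  4^-1 * \sum_(q < n) invmx (L_metric f z) a q *
    (\sum_(m < n) z.2 0 m * dx m (dxdot q f) z - dx q f z).

(* Gamma i x a b c is Gamma^a_{bc} at the point with coordinates x in chart i;
   only its values for x in chart_image i are relevant. *)
Definition connection_coeffs (R : realType) (n : nat)
    (M : smoothManifold R n) : Type :=
  chart_index M -> 'rV[R]_n -> 'I_n -> 'I_n -> 'I_n -> R.

Definition induced_connection (R : realType) (n : nat)
    (M : smoothManifold R n) (A : set (tangent M)) (L : tangent M -> R)
    (Gamma : connection_coeffs M) : Prop :=
  forall (i : chart_index M) z, tset A i z -> forall a : 'I_n,
    let G := spray (L \o tvec i) in
    G a z = 2^-1 * \sum_(b < n) \sum_(c < n)
              Gamma i z.1 a b c * z.2 0 b * z.2 0 c /\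
    (forall b c : 'I_n, Gamma i z.1 a b c = dxdot b (dxdot c (G a)) z).

Definition berwald_type (R : realType) (n : nat) (M : smoothManifold R n)
    (A : set (tangent M)) (L : tangent M -> R) : Prop :=
  exists Gamma : connection_coeffs M, induced_connection A L Gamma.

Definition ricci (R : realType) (n : nat) (M : smoothManifold R n)
    (Gamma : connection_coeffs M) (i : chart_index M) (x : 'rV[R]_n)
    (a b : 'I_n) : R :=
  let d (k : 'I_n) (f : 'rV[R]_n -> R) : R := 'D_(delta_mx 0 k) f x in
  \sum_(m < n) d m (fun y => Gamma i y m a b)
  - \sum_(m < n) d b (fun y => Gamma i y m a m)
  + \sum_(m < n) \sum_(s < n) Gamma i x m m s * Gamma i x s a b
  - \sum_(m < n) \sum_(s < n) Gamma i x m b s * Gamma i x s a m.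

Definition ricci_symmetric (R : realType) (n : nat) (M : smoothManifold R n)
    (Gamma : connection_coeffs M) : Prop :=
  forall (i : chart_index M) x, chart_image i x ->
    forall a b : 'I_n, ricci Gamma i x a b = ricci Gamma i x b a.

(* A field g of bilinear forms: g p is the matrix of a bilinear form on the
   tangent space at p, in the components tcomp.  local_form g i x is its
   matrix in the coordinate basis of chart i. *)
Definition local_form (R : realType) (n : nat) (M : smoothManifold R n)
    (g : M -> 'M[R]_n) (i : chart_index M) (x : 'rV[R]_n) : 'M[R]_n :=
  \matrix_(a, b)
    (tcomp (tvec i (x, delta_mx 0 a)) *m g (chart_inv i x)
       *m (tcomp (tvec i (x, delta_mx 0 b)))^T) 0 0.

Record pseudo_riemannian (R : realType) (n : nat) (M : smoothManifold R n)
    (g : M -> 'M[R]_n) : Prop := PseudoRiemannian {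
  pseudo_riemannian_sym : forall p, (g p)^T = g p;
  pseudo_riemannian_nondegenerate : forall p, g p \in unitmx;
  pseudo_riemannian_smooth : forall (i : chart_index M) (a b : 'I_n),
    smooth_on (chart_image i) (fun x => local_form g i x a b)
}.

Definition christoffel (R : realType) (n : nat) (M : smoothManifold R n)
    (g : M -> 'M[R]_n) : connection_coeffs M :=
  fun i x a b c =>
  let h := local_form g i in
  let d (k : 'I_n) (f : 'rV[R]_n -> R) : R := 'D_(delta_mx 0 k) f x in
  2^-1 * \sum_(q < n) invmx (h x) a q *
    (d b (fun y => h y q c) + d c (fun y => h y q b) - d q (fun y => h y b c)).

Definition levi_civita_of (R : realType) (n : nat) (M : smoothManifold R n)
    (g : M -> 'M[R]_n) (Gamma : connection_coeffs M) : Prop :=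
  forall (i : chart_index M) x, chart_image i x ->
    forall a b c : 'I_n, Gamma i x a b c = christoffel g i x a b c.

(* Main.v *)
Require Import Defs.
From mathcomp Require Import all_boot all_order all_algebra.
From mathcomp Require Import all_classical all_reals all_analysis.
From mathcomp Require Import ring lra.

(** In two dimensions a product of powers of two independent 1-forms is of
    Berwald type.  On the plane take L = e^f y0^a y1^b with a + b = 2 and
    f = x0 x1, on the cone y0, y1 > 0.  Its spray is that of the connection
    whose only nonzero coefficients are Gamma^0_00 = (d_0 f) / a and
    Gamma^1_11 = (d_1 f) / b, whence R_01 = - 1 / a and R_10 = - 1 / b, which
    differ for a <> b.  The determinant of the L-metric has the sign of - a b,
    so positive exponents make it Lorentzian and make L vanish on the boundary
    of the cone; the choice here is a = 1/2, b = 3/2.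

    If g were a metric with this Levi-Civita connection, then
    d_k (det g) = 2 Gamma^m_km det g, that is, log |det g| would have the
    gradient (4 x1, 4/3 x0), which is not closed. *)

Set Implicit Arguments.
Unset Strict Implicit.
Unset Printing Implicit Defensive.

Import Order.TTheory GRing.Theory Num.Theory.
Import numFieldNormedType.Exports.

Local Open Scope classical_set_scope.
Local Open Scope ring_scope.

(** * Second countability of R^n *)

Lemma rV_second_countable (R : realType) (n : nat) :
  @second_countable 'rV[R]_n.
Proof.
pose q_ (s : 'rV[rat]_n * nat) : set 'rV[R]_n :=
  ball (map_mx ratr s.1 : 'rV[R]_n) s.2.+1%:R^-1.
exists [set q_ s | s in setT].
  exact/(sub_countable (card_image_le _ _))/countableP.
split=> [_ [s _ <-]|x V]; first exact: ball_open.
rewrite -nbhs_ballE => -[e /= e0 xeV].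
(* Half of [e] suffices: a ball of radius [d] whose centre is within [d] of [x] lies in the ball of
   radius [2 * d] around [x]. *)
have [k] : exists k : nat, 0 + k.+1%:R^-1 < e / 2.
  by apply: ltr_add_invr; rewrite divr_gt0.
rewrite add0r; set d : R := k.+1%:R^-1 => de.
have d0 : 0 < d by rewrite invr_gt0.
have /choice[r rP] (j : 'I_n) : exists q : rat,
    `|x ord0 j - ratr q| < d.
  have [|q] := @rat_in_itvoo _ (x ord0 j - d) (x ord0 j); first lra.
  by rewrite in_itv/= => /andP[? ?]; exists q; rewrite ltr_norml; lra.
exists (q_ (\row_j r j, k)).
  split; first by exists (\row_j r j, k).
  rewrite /q_/=; split=> // i j.
  by rewrite !mxE ord1 -ball_normE/= distrC; exact: rP.
move=> y [_ yb]; apply: xeV; split=> // i j.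
rewrite ord1 -ball_normE/=.
have {yb} := yb ord0 j; rewrite !mxE -ball_normE/= -/d => yb.
rewrite (_ : x _ _ - y _ _ =
  x ord0 j - ratr (r j) + (ratr (r j) - y ord0 j)); last by ring.
have := rP j; have := ler_normD (x ord0 j - ratr (r j)) (ratr (r j) - y ord0 j).
lra.
Qed.

(** * Calculus of directional derivatives *)

Section directional_derivatives.
Context {R : realType} {V : normedModType R}.
Implicit Types (f g : V -> R) (x v : V).

(** The difference quotient is constant for nonzero [h]. This covers all coordinate functions. *)
Lemma is_derive_affine_line f x v d :
  (forall h : R, f (h *: v + x) = h * d + f x) -> is_derive x v f d.
Proof.
move=> fE; have fd : \forall h \near (0 : R)^',
    h^-1 *: ((f \o shift x) (h *: v) - f x) = d.
  near=> h; rewrite /= fE addrK /GRing.scale/= mulKf//.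
  by near: h; exact: nbhs_dnbhs_neq 0.
split; first by apply: (is_cvg_near_cst d); exact: fd.
by apply: lim_near_cst => //; exact: fd.
Unshelve. all: by end_near. Qed.

(** Both sides have the same difference quotient, which opens directional derivatives to the
    one-variable chain rule. *)
Lemma is_derive_lineP f x v d :
  is_derive x v f d <-> is_derive (0 : R) 1 (fun h => f (h *: v + x)) d.
Proof.
have E : 'D_1 (fun h : R => f (h *: v + x)) 0 = 'D_v f x.
  rewrite /derive; set F := (F in F @ _); set G := (F in _ = lim (F @ _)).
  suff -> : F = G by [].
  apply/funext => h; rewrite /F /G /=.
  by rewrite addr0 scale0r add0r /GRing.scale/= mulr1.
split=> -[df <-]; split=> //.
- exact: (derivable1P _ _ _).1.
- exact: (derivable1P _ _ _).2.
Qed.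

Lemma is_derive_chain (g : R -> R) f x v a b :
  is_derive (f x) 1 g a -> is_derive x v f b ->
  is_derive x v (g \o f) (a * b).
Proof.
move=> ga /is_derive_lineP fb; apply/is_derive_lineP.
have -> : (fun h : R => (g \o f) (h *: v + x)) =
  g \o (fun h => f (h *: v + x)) by [].
by apply: is_derive1_comp; rewrite ?scale0r ?add0r.
Qed.

Lemma is_derive_mul f g x v a b : is_derive x v f a -> is_derive x v g b ->
  is_derive x v (fun y => f y * g y) (f x * b + g x * a).
Proof. exact: is_deriveM. Qed.

Lemma is_derive_pow f x v a n : is_derive x v f a ->
  is_derive x v (fun y => f y ^+ n) (n%:R * f x ^+ n.-1 * a).
Proof.
move=> fa; have -> : (fun y => f y ^+ n) = f ^+ n.
  by apply/funext => y; rewrite exprfctE.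
exact: is_deriveX.
Qed.

Lemma is_derive_inv f x v a : f x != 0 -> is_derive x v f a ->
  is_derive x v (fun y => (f y)^-1) (- (f x)^-1 ^+ 2 * a).
Proof.
move=> fx0 fa; apply: (is_derive_chain (g := GRing.inv)) fa.
apply: (is_derive_eq (is_deriveV fx0 (is_derive_id _ _))).
by rewrite /GRing.scale/= mulr1 exprVn.
Qed.

End directional_derivatives.

(** * Smooth functions and function algebras *)

Section smooth_functions.
Context {R : realType} {V W : normedModType R}.

Lemma eq_Ck_on (U : set V) k (f g : V -> W) : open U ->
  (forall x, U x -> f x = g x) -> Ck_on k U f -> Ck_on k U g.
Proof.
move=> oU; elim: k f g => [|k IH] f g fg /= [fc fd];
  have fgn x : U x -> \near x, f x = g x
    by move=> Ux; near=> y; apply: fg; near: y; exact: open_nbhs_nbhs.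
all: split=> [x Ux|].
- rewrite /prop_for /continuous_at -(fg x Ux).
  exact/(cvg_trans _ (fc x Ux))/near_eq_cvg/fgn.
- by [].
- rewrite /prop_for /continuous_at -(fg x Ux).
  exact/(cvg_trans _ (fc x Ux))/near_eq_cvg/fgn.
move=> v; have [fdv Ckf] := fd v; split=> [x Ux|].
  have := near_eq_is_derive (fgn x Ux) (derivableP (fdv x Ux)).
  by case.
apply: IH Ckf => x Ux; exact/near_eq_derive/fgn.
Unshelve. all: by end_near. Qed.

(** Induction on [k]: each derivative agrees on [U] with another member of [S], which replaces any
    formula for iterated derivatives. *)
Lemma smooth_on_derive_stable (U : set V) (S : set (V -> W)) : open U ->
  (forall f, S f -> forall x, U x -> {for x, continuous f}) ->
  (forall f, S f -> forall v, exists2 g, S g &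
     forall x, U x -> is_derive x v f (g x)) ->
  forall f, S f -> smooth_on U f.
Proof.
move=> oU Sc Sd f Sf k; elim: k f Sf => [|k IH] f Sf /=.
  by split=> //; exact: Sc.
split=> [|v]; first exact: Sc.
have [g Sg fg] := Sd f Sf v; split=> [x /fg[]//|].
by apply: eq_Ck_on (IH g Sg) => // x Ux; have [_ ->] := fg x Ux.
Qed.

Lemma smooth_on_cst (U : set V) (c : W) : open U -> smooth_on U (cst c).
Proof.
move=> oU; apply: (@smooth_on_derive_stable U (range cst)) => //.
- by move=> _ [d _ <-] x _; exact: cst_continuous.
- move=> _ [d _ <-] v; exists (cst 0); first by exists 0.
  by move=> x _; exact: is_derive_cst.
Qed.

End smooth_functions.

Lemma smooth_on_id (R : realType) (V : normedModType R) (U : set V) :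
  open U -> smooth_on U (@id V).
Proof.
move=> oU k; have idc x : U x -> {for x, continuous (@id V)} by move=> _.
case: k => [|k]; split=> // v; split=> //.
by apply: eq_Ck_on (smooth_on_cst v oU k) => // x _; rewrite derive_id.
Qed.

Section function_algebra.
Context {R : realType} {V : normedModType R}.

Inductive generated_algebra (G : set (V -> R)) : set (V -> R) :=
| generated_algebra_gen f : G f -> generated_algebra G f
| generated_algebra_cst c : generated_algebra G (cst c)
| generated_algebraD f g : generated_algebra G f -> generated_algebra G g ->
    generated_algebra G (f \+ g)
| generated_algebraM f g : generated_algebra G f -> generated_algebra G g ->
    generated_algebra G (f \* g).

(** By the Leibniz rule the whole algebra is stable under derivation once the derivatives of its
    generators lie in it. *)
Lemma smooth_on_generated_algebra (U : set V) (G : set (V -> R)) : open U ->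
  (forall f, G f -> forall x, U x -> {for x, continuous f}) ->
  (forall f, G f -> forall v, exists2 g, generated_algebra G g &
     forall x, U x -> is_derive x v f (g x)) ->
  forall f, generated_algebra G f -> smooth_on U f.
Proof.
move=> oU Gc Gd; apply: smooth_on_derive_stable => //.
- move=> f; elim=> [{}f|c|{}f g _ fc _ gc|{}f g _ fc _ gc] x.
  + exact: Gc.
  + by move=> _; exact: cst_continuous.
  + by move=> Ux; apply: continuousD; [exact: fc|exact: gc].
  + by move=> Ux; apply: continuousM; [exact: fc|exact: gc].
- move=> f; elim=> [{}f|c|{}f g Sf fd Sg gd|{}f g Sf fd Sg gd] v.
  + exact: Gd.
  + exists (cst 0); first exact: generated_algebra_cst.
    by move=> x _; exact: is_derive_cst.
  + have [f' Sf' ff'] := fd v; have [g' Sg' gg'] := gd v.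
    exists (f' \+ g'); first exact: generated_algebraD.
    by move=> x Ux; apply: is_deriveD; [exact: ff'|exact: gg'].
  + have [f' Sf' ff'] := fd v; have [g' Sg' gg'] := gd v.
    exists ((f \* g') \+ (g \* f')).
      by apply: generated_algebraD; exact: generated_algebraM.
    by move=> x Ux; apply: is_deriveM; [exact: ff'|exact: gg'].
Qed.

End function_algebra.

(** [is_derive_lineP] concerns the parameter 0; the substitution [h - t] carries it to any point of
    the line. *)
Lemma is_derive_along_line (R : realType) (V : normedModType R) (f : V -> R)
    (x v : V) (t d : R) :
  is_derive (t *: v + x) v f d -> is_derive t 1 (fun h => f (h *: v + x)) d.
Proof.
move=> /is_derive_lineP fd.
have -> : (fun h : R => f (h *: v + x)) =
    (fun k => f (k *: v + (t *: v + x))) \o (fun h => h - t).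
  by apply/funext => h /=; rewrite addrA -scalerDl subrK.
rewrite -[d]mulr1; apply: is_derive1_comp; first by rewrite subrr.
by rewrite -[X in is_derive _ _ _ X]subr0; exact: is_deriveB.
Qed.

Lemma derive_eq_on (R : realType) (V W : normedModType R) (U : set V)
    (f g : V -> W) (x v : V) :
  open U -> U x -> (forall y, U y -> f y = g y) -> 'D_v f x = 'D_v g x.
Proof.
move=> oU Ux fg; apply: near_eq_derive; near=> y; apply: fg.
by near: y; exact: open_nbhs_nbhs.
Unshelve. all: by end_near. Qed.

(** * R^n as a manifold with a single chart *)

Section euclidean_manifold.
Context {R : realType} {n : nat}.

Lemma euclidean_open_image (i : unit) : open ((@id 'rV[R]_n) @` setT).
Proof. by rewrite image_id; exact: openT. Qed.

Lemma euclidean_transition (i j : unit) :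
  smooth_on ((@id 'rV[R]_n) @` (setT `&` setT)) (@id 'rV[R]_n \o @id 'rV[R]_n).
Proof. by rewrite setIT image_id; apply: smooth_on_id; exact: openT. Qed.

Definition euclidean_manifold : smoothManifold R n :=
  @SmoothManifold R n 'rV[R]_n (@norm_hausdorff _ _) (@rV_second_countable R n)
    unit (fun=> setT) (fun=> id) (fun=> id) (fun=> tt)
    (fun _ => I) (fun _ => openT) euclidean_open_image
    (fun _ _ _ => erefl) (fun _ _ _ => cvg_id) (fun _ _ _ => cvg_id)
    euclidean_transition.

Lemma chart_image_euclidean (i : chart_index euclidean_manifold) x :
  chart_image i x.
Proof. by exists x. Qed.

(** The transition map is the identity, which is its own differential. *)
Lemma tvec_euclidean (i : chart_index euclidean_manifold) z :
  tvec i z = @Tangent R n euclidean_manifold z.1 z.2.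
Proof.
rewrite /tvec /=; congr Tangent.
by rewrite -[LHS]/('d (@id 'rV[R]_n) (z.1) (z.2)) diff_val.
Qed.

Lemma tset_euclidean (A : set (tangent euclidean_manifold))
    (i : chart_index euclidean_manifold) :
  tset A i = [set z | A (@Tangent R n euclidean_manifold z.1 z.2)].
Proof.
apply/seteqP; split=> z; rewrite /tset/= tvec_euclidean; first by case.
by move=> Az; split=> //; exact: chart_image_euclidean.
Qed.

Lemma local_form_euclidean (g : euclidean_manifold -> 'M[R]_n)
    (i : chart_index euclidean_manifold) x :
  local_form g i x = g x.
Proof.
apply/matrixP => a b; rewrite mxE !tvec_euclidean /= -rowE !mxE.
rewrite (bigD1 b)//= !mxE !eqxx mulr1 big1 ?addr0// => j jb.
by rewrite !mxE (negbTE jb) andbF mulr0.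
Qed.

End euclidean_manifold.

(** * Levi-Civita connections are metric *)

Section levi_civita.
Context {R : realType} {n : nat} {M : smoothManifold R n}.
Variables (g : M -> 'M[R]_n) (i : chart_index M) (x : 'rV[R]_n).
Hypothesis g_sym : forall p, (g p)^T = g p.

Let h := local_form g i.
Let d (k a b : 'I_n) : R := 'D_(delta_mx 0 k) (fun y => h y a b) x.

Lemma local_form_sym y a b : h y a b = h y b a.
Proof.
rewrite [LHS]mxE [RHS]mxE; set u := tcomp _; set v := tcomp _.
have <- : (v *m g (chart_inv i y) *m u^T)^T = u *m g (chart_inv i y) *m v^T.
  by rewrite !trmx_mul trmxK g_sym mulmxA.
by rewrite [LHS]mxE.
Qed.

(** Lowering the upper index cancels the inverse metric in the Christoffel symbol. *)
Lemma christoffel_lower (r b c : 'I_n) : h x \in unitmx ->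
  \sum_a h x r a * christoffel g i x a b c =
  2^-1 * (d b r c + d c r b - d r b c).
Proof.
move=> hx; pose t := \col_q (d b q c + d c q b - d q b c).
transitivity ((h x *m (2^-1 *: (invmx (h x) *m t))) r 0).
  rewrite mxE; apply: eq_bigr => a _; congr (_ * _).
  by rewrite !mxE; congr (_ * _); apply: eq_bigr => q _; rewrite [in RHS]mxE.
by rewrite -scalemxAr mulKVmx// !mxE.
Qed.

(** This is the vanishing of the covariant derivative of [h]. In the sum of the two lowered symbols,
    symmetry of [h] cancels all terms but two copies of [2^-1 * d c r b]. *)
Lemma metric_compatibility (r b c : 'I_n) : h x \in unitmx ->
  d c r b = \sum_a h x r a * christoffel g i x a b c +
            \sum_a h x b a * christoffel g i x a r c.
Proof.
move=> hx; rewrite !christoffel_lower//.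
have dS k p q : d k p q = d k q p.
  by rewrite /d; congr derive; apply/funext => y; exact: local_form_sym.
by rewrite (dS c b r) (dS r b c) (dS b r c); field.
Qed.

End levi_civita.

(** * Dimension two, and an obstruction to a logarithmic potential *)

Lemma sum2E (T : nmodType) (F : 'I_2 -> T) : \sum_i F i = F 0 + F 1.
Proof. by rewrite big_ord_recl big_ord1; congr (_ + F _); exact/val_inj. Qed.

Lemma ord2_ind (P : 'I_2 -> Prop) : P 0 -> P 1 -> forall i, P i.
Proof.
move=> P0 P1 [[|[|//]] i2].
- by rewrite (_ : Ordinal i2 = 0)//; exact/val_inj.
- by rewrite (_ : Ordinal i2 = 1)//; exact/val_inj.
Qed.

Lemma det_mx22 (K : comNzRingType) (A : 'M[K]_2) :
  \det A = A 0 0 * A 1 1 - A 0 1 * A 1 0.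
Proof.
rewrite (expand_det_row _ 0) sum2E /cofactor !det_mx11 !mxE/= expr0 expr1.
rewrite mul1r mulN1r mulrN; congr (_ * A _ _ - _ * A _ _); exact/val_inj.
Qed.

(* The derivative along x1 gives D (e_1 + s e_0) = D (s e_0) exp (b s); the two
   sides have derivatives a D e_1 and b D e_1 at s = 0. *)
Lemma eq0_of_log_gradient_not_closed (R : realType) (D : 'rV[R]_2 -> R)
    (a b : R) :
  (forall x : 'rV_2, is_derive x (delta_mx 0 0) D (a * x 0 1 * D x)) ->
  (forall x : 'rV_2, is_derive x (delta_mx 0 1) D (b * x 0 0 * D x)) ->
  a != b -> D 0 = 0.
Proof.
move=> D0 D1 ab; pose e i : 'rV[R]_2 := delta_mx 0 i.
have transport s : D (e 1 + s *: e 0) = D (s *: e 0) * expR (b * s).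
  (* On this line [x 0 0] stays equal to [s], so the second equation has the constant coefficient
     [b * s]; its integrating factor makes [w] constant. *)
  pose w t := D (t *: e 1 + s *: e 0) * expR (- (b * s) * t).
  have w0 (t : R) : is_derive t 1 w 0.
    have Dt := is_derive_along_line (D1 (t *: e 1 + s *: e 0)).
    have Et : is_derive t 1 (fun k : R => expR (- (b * s) * k))
        (expR (- (b * s) * t) * (- (b * s))).
      apply: (@is_derive1_comp _ expR (fun k => - (b * s) * k)).
      by apply: is_derive_affine_line => k; rewrite mulrDr mulrCA mulr1.
    apply: (is_derive_eq (is_deriveM Dt Et)).
    by rewrite !mxE/= /GRing.scale/=; ring.
  have := is_derive_0_is_cst 1 0 w0; rewrite /w !scale0r !add0r scale1r.
  rewrite mulr0 expR0 !mulr1 => <-.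
  by rewrite -mulrA -expRD addNr expR0 mulr1.
have dl : is_derive (0 : R) 1 (fun s : R => D (s *: e 0 + e 1)) (a * D (e 1)).
  have := D0 (0 *: e 0 + e 1); rewrite scale0r add0r !mxE/= mulr1 => H.
  by apply: is_derive_along_line; rewrite scale0r add0r.
have dr : is_derive (0 : R) 1 (fun s : R => D (s *: e 0 + e 1)) (b * D 0).
  have -> : (fun s : R => D (s *: e 0 + e 1)) =
      (fun s : R => D (s *: e 0 + 0)) * (fun s => expR (b * s)).
    by apply/funext => s; rewrite addrC transport -[in LHS](addr0 (s *: e 0)).
  (* On this axis [x 0 1] is 0, so the first equation gives derivative 0 and only the exponential
     contributes to [dr]. *)
  have H1 : is_derive (0 : R) 1 (fun s : R => D (s *: e 0 + 0)) 0.
    have := D0 0; rewrite !mxE/= mulr0 mul0r => H.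
    by apply: is_derive_along_line; rewrite scale0r add0r.
  have H2 : is_derive (0 : R) 1 (fun k : R => expR (b * k)) (expR (b * 0) * b).
    apply: (@is_derive1_comp _ expR (fun k => b * k)).
    by apply: is_derive_affine_line => k; rewrite mulrDr mulrCA mulr1.
  apply: (is_derive_eq (is_deriveM H1 H2)).
  by rewrite mulr0 expR0 scaler0 addr0 scale0r addr0 /GRing.scale/= mul1r mulrC.
have := @derive_val _ _ _ _ _ _ _ dl; rewrite (@derive_val _ _ _ _ _ _ _ dr).
(* At [s = 0] transport gives [D (e 1) = D 0]; comparing [dl] with [dr] then yields
   [(a - b) * D 0 = 0]. *)
have := transport 0; rewrite mulr0 expR0 mulr1 scale0r addr0 => ->.
move/eqP; rewrite eq_sym -subr_eq0 -mulrBl mulf_eq0 subr_eq0.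
by rewrite (negbTE ab) => /eqP.
Qed.

(** * The affine connection on the plane *)

Section plane_connection.
Context {R : realType}.
Let plane := @euclidean_manifold R 2.

(** The two values are (d_0 f) / a and (d_1 f) / b for f = x0 x1, a = 1/2 and b = 3/2. *)
Definition plane_connection (x : 'rV[R]_2) (a b c : 'I_2) : R :=
  if (a == b) && (a == c) then if a == 0 then 2 * x 0 1 else 2 / 3 * x 0 0
  else 0.

(** At the origin the quadratic terms vanish, leaving R_01 = - d_1 Gamma^0_00 = - 2 and R_10 = - d_0
    Gamma^1_11 = - 2/3. *)
Lemma ricci_plane_connection_not_symmetric :
  ~ ricci_symmetric ((fun=> plane_connection) : connection_coeffs plane).
Proof.
move=> /(_ tt 0 (chart_image_euclidean tt 0) 0 1).
have lin i (x : 'rV[R]_2) (c : R) k :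
    'D_(delta_mx 0 k) (fun y : 'rV[R]_2 => c * y 0 i) x = c *+ (i == k).
  apply: derive_val; apply: is_derive_affine_line => h.
  by rewrite !mxE/= mulrDr mulrCA mulr_natr mulrnAr.
rewrite /ricci !sum2E /plane_connection/= !derive_cst !lin/= !mxE.
by lra.
Qed.

Lemma plane_connection_not_levi_civita (g : plane -> 'M[R]_2) :
  pseudo_riemannian g ->
  ~ levi_civita_of g ((fun=> plane_connection) : connection_coeffs plane).
Proof.
move=> [g_sym g_unit g_smooth] lc.
have lfE : local_form g tt = g.
  by apply/funext => x; exact: local_form_euclidean.
(* Derivability comes from smoothness of order 1, the value from metric compatibility. *)
have gd c r b x : is_derive x (delta_mx 0 c) (fun y => g y r b)
    (\sum_a g x r a * plane_connection x a b c +
     \sum_a g x b a * plane_connection x a r c).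
  have [_ /(_ (delta_mx 0 c))[dg _]] := g_smooth tt r b 1%N.
  rewrite lfE in dg; split; first exact/dg/chart_image_euclidean.
  have := @metric_compatibility _ _ _ g tt x g_sym r b c.
  rewrite lfE => -> //; congr (_ + _); apply: eq_bigr => a _.
  - by rewrite -lc//; exact: chart_image_euclidean.
  - by rewrite -lc//; exact: chart_image_euclidean.
have gS x : g x 1 0 = g x 0 1 by rewrite -[in LHS]g_sym mxE.
have detE : (fun y => \det (g y)) =
    (fun y => g y 0 0) * (fun y => g y 1 1) -
    (fun y => g y 0 1) * (fun y => g y 1 0).
  by apply/funext => y; rewrite det_mx22.
have /eqP : \det (g 0) = 0.
  (* The slopes 4 and 4/3 come from 2 Gamma^0_00 = 4 x1 and 2 Gamma^1_11 = (4/3) x0. *)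
  apply: (@eq0_of_log_gradient_not_closed R (fun y => \det (g y)) 4 (4 / 3)).
  - move=> x; rewrite detE.
    apply: (is_derive_eq (is_deriveB (is_deriveM (gd 0 0 0 x) (gd 0 1 1 x))
                                     (is_deriveM (gd 0 0 1 x) (gd 0 1 0 x)))).
    by rewrite !sum2E /plane_connection/= det_mx22 !gS /GRing.scale/=; ring.
  - move=> x; rewrite detE.
    apply: (is_derive_eq (is_deriveB (is_deriveM (gd 1 0 0 x) (gd 1 1 1 x))
                                     (is_deriveM (gd 1 0 1 x) (gd 1 1 0 x)))).
    by rewrite !sum2E /plane_connection/= det_mx22 !gS /GRing.scale/=; field.
  - by apply/eqP; lra.
by have := g_unit 0; rewrite unitmxE unitfE => /negbTE ->.
Qed.

End plane_connection.

(** * The Finsler function on the plane: derivatives, metric and spray *)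

Section kropina_plane.
Context {R : realType}.
Local Notation plane := (@euclidean_manifold R 2).
Local Notation V := ('rV[R]_2 * 'rV[R]_2)%type.
Implicit Types z w : V.

(** On the cone this is e^f y0^(1/2) y1^(3/2). Since [Num.sqrt] is 0 on negative reals, the formula
    also defines a function that vanishes outside the cone. *)
Definition kropina_fun z : R :=
  expR (z.1 0 0 * z.1 0 1) * (Num.sqrt (z.2 0 0) * Num.sqrt (z.2 0 1) ^+ 3).

Definition positive_quadrant : set V := [set z : V | forall i, 0 < z.2 0 i].

(** The exponents of y0 and y1. *)
Definition kropina_weight (i : 'I_2) : R := if i == 0 then 1 / 2 else 3 / 2.

(** The partial derivative d_i f of f = x0 x1. *)
Definition swap_coord z (i : 'I_2) : R := if i == 0 then z.1 0 1 else z.1 0 0.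

Local Notation F := kropina_fun.
Local Notation U := positive_quadrant.
Local Notation wt := kropina_weight.
Local Notation sw := swap_coord.

Lemma fst_coord_continuous i : continuous (fun z : V => z.1 0 i).
Proof.
move=> z; apply: (@continuous_comp _ _ _ fst (fun x : 'rV[R]_2 => x 0 i)).
  exact: cvg_fst.
exact: coord_continuous.
Qed.

Lemma snd_coord_continuous i : continuous (fun z : V => z.2 0 i).
Proof.
move=> z; apply: (@continuous_comp _ _ _ snd (fun x : 'rV[R]_2 => x 0 i)).
  exact: cvg_snd.
exact: coord_continuous.
Qed.

Lemma open_positive_quadrant : open U.
Proof.
have -> : U = [set z : V | 0 < z.2 0 0] `&` [set z : V | 0 < z.2 0 1].
  apply/seteqP; split=> [z Uz|z [z0 z1]]; first by split; exact: Uz.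
  exact: ord2_ind.
by apply: openI; apply: (open_comp _ (@open_gt R 0)) => z _;
  exact: snd_coord_continuous.
Qed.

(** Continuity holds beyond the open cone, as the extension to its closure requires. *)
Lemma kropina_continuous : continuous F.
Proof.
have sq i : continuous (fun z : V => Num.sqrt (z.2 0 i)).
  move=> z; apply: continuous_comp; first exact: snd_coord_continuous.
  exact: sqrt_continuous.
move=> z; rewrite /kropina_fun; apply: cvgM.
  apply: continuous_comp; last exact: continuous_expR.
  by apply: cvgM; exact: fst_coord_continuous.
apply: cvgM; first exact: sq.
by apply: (@continuous_comp V R R (fun z : V => Num.sqrt (z.2 0 1))
                                 (fun x : R => x ^+ 3));
  [exact: sq|exact: exprn_continuous].
Qed.

Lemma is_derive_fst_coord z w i :
  is_derive z w (fun z : V => z.1 0 i) (w.1 0 i).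
Proof. by apply: is_derive_affine_line => h; rewrite /= !mxE. Qed.

Lemma is_derive_snd_coord z w i :
  is_derive z w (fun z : V => z.2 0 i) (w.2 0 i).
Proof. by apply: is_derive_affine_line => h; rewrite /= !mxE. Qed.

Lemma kropina_gt0 z : U z -> 0 < F z.
Proof.
by move=> Uz; rewrite /F !mulr_gt0 ?expR_gt0 ?exprn_gt0 ?sqrtr_gt0.
Qed.

(** Logarithmic differentiation: on the cone log L = x0 x1 + sum_i [wt i] log y_i. *)
Lemma is_derive_kropina z w : U z -> is_derive z w F
  (F z * (\sum_i (w.1 0 i * sw z i + wt i * (z.2 0 i)^-1 * w.2 0 i))).
Proof.
move=> Uz.
have sq0 i : Num.sqrt (z.2 0 i) != 0 by rewrite gt_eqF ?sqrtr_gt0.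
have dS i : is_derive z w (fun z : V => Num.sqrt (z.2 0 i))
    ((2 * Num.sqrt (z.2 0 i))^-1 * w.2 0 i).
  apply: (is_derive_chain (g := Num.sqrt)); last exact: is_derive_snd_coord.
  exact: is_derive1_sqrt.
have dE := is_derive_mul (is_derive_fst_coord z w 0)
                         (is_derive_fst_coord z w 1).
have {}dE := is_derive_chain (is_derive_expR _) dE.
have dF := is_derive_mul dE (is_derive_mul (dS 0) (is_derive_pow 3 (dS 1))).
apply: (is_derive_eq dF); rewrite sum2E /F /wt /sw /=.
(* With y_i written as the square of its root, the claim is a rational identity in the roots. *)
have yE i : z.2 0 i = Num.sqrt (z.2 0 i) ^+ 2 by rewrite sqr_sqrtr// ltW.
rewrite [in (z.2 0 0)^-1]yE [in (z.2 0 1)^-1]yE.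
by field; rewrite !sq0.
Qed.

Lemma is_derive_inv_snd_coord z w i : U z ->
  is_derive z w (fun z : V => (z.2 0 i)^-1) (- (z.2 0 i)^-1 ^+ 2 * w.2 0 i).
Proof.
move=> Uz; apply: is_derive_inv; first by rewrite gt_eqF.
exact: is_derive_snd_coord.
Qed.

(** L, the x_i and the 1 / y_i generate an algebra stable under derivation: dL is L times a
    combination of the others, and d(1 / y_i) = - (1 / y_i)^2 dy_i. *)
Lemma kropina_smooth : smooth_on U F.
Proof.
pose u i z : R := z.1 0 i; pose v i z : R := (z.2 0 i)^-1.
pose G : set (V -> R) := [set F] `|` (range u `|` range v).
have GF : generated_algebra G F by apply: generated_algebra_gen; left.
have Gu i : generated_algebra G (u i).
  by apply: generated_algebra_gen; right; left; exists i.
have Gv i : generated_algebra G (v i).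
  by apply: generated_algebra_gen; right; right; exists i.
have GZ c f : generated_algebra G f -> generated_algebra G (cst c \* f).
  by apply: generated_algebraM; exact: generated_algebra_cst.
apply: (smooth_on_generated_algebra (G := G)) => //.
- exact: open_positive_quadrant.
- move=> _ [->|[] [i _ <-]] z Uz.
  + exact: kropina_continuous.
  + exact: (@fst_coord_continuous i z).
  + by apply: cvgV; [rewrite gt_eqF|exact: (@snd_coord_continuous i z)].
- move=> _ [->|[] [i _ <-]] w.
  + exists (F \* ((cst (w.1 0 0) \* u 1 \+ cst (wt 0 * w.2 0 0) \* v 0) \+
                  (cst (w.1 0 1) \* u 0 \+ cst (wt 1 * w.2 0 1) \* v 1))).
      by apply: generated_algebraM => //;
        apply: generated_algebraD; apply: generated_algebraD; exact: GZ.
    move=> z Uz; apply: (is_derive_eq (is_derive_kropina w Uz)).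
    by rewrite sum2E /u /v /swap_coord /=; ring.
  + exists (cst (w.1 0 i)); first exact: generated_algebra_cst.
    by move=> z _; exact: is_derive_fst_coord.
  + exists (cst (- w.2 0 i) \* (v i \* v i)).
      by apply: GZ; exact: generated_algebraM.
    move=> z Uz; apply: (is_derive_eq (is_derive_inv_snd_coord w i Uz)).
    by rewrite /v /=; ring.
Qed.

Lemma dxdot_kropina b z : U z -> dxdot b F z = F z * (wt b * (z.2 0 b)^-1).
Proof.
move=> Uz; rewrite /dxdot (@derive_val _ _ _ _ _ _ _ (is_derive_kropina _ Uz)).
by congr (_ * _); elim/ord2_ind: b; rewrite sum2E !mxE/=; ring.
Qed.

Lemma dx_kropina b z : U z -> dx b F z = F z * sw z b.
Proof.
move=> Uz; rewrite /dx (@derive_val _ _ _ _ _ _ _ (is_derive_kropina _ Uz)).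
by congr (_ * _); elim/ord2_ind: b; rewrite sum2E !mxE/=; ring.
Qed.

Lemma is_derive_dxdot_kropina b z w : U z ->
  is_derive z w (fun z : V => F z * (wt b * (z.2 0 b)^-1))
    (F z * (wt b * (z.2 0 b)^-1 *
      (\sum_i (w.1 0 i * sw z i + wt i * (z.2 0 i)^-1 * w.2 0 i)) -
      wt b * (z.2 0 b)^-1 ^+ 2 * w.2 0 b)).
Proof.
move=> Uz; have dv := is_derive_inv_snd_coord w b Uz.
have dF := is_derive_mul (is_derive_kropina w Uz)
  (is_derive_mul (is_derive_cst (wt b) z w) dv).
by apply: (is_derive_eq dF); rewrite /=; ring.
Qed.

Lemma dx_dxdot_kropina a b z : U z ->
  dx a (dxdot b F) z = F z * (wt b * (z.2 0 b)^-1 * sw z a).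
Proof.
move=> Uz; rewrite /dx.
rewrite (derive_eq_on _ open_positive_quadrant Uz (dxdot_kropina b)).
rewrite (@derive_val _ _ _ _ _ _ _ (is_derive_dxdot_kropina b _ Uz)).
by congr (_ * _); elim/ord2_ind: a; rewrite sum2E !mxE/=; ring.
Qed.

Lemma L_metric_kropina z : U z -> L_metric F z =
  \matrix_(a, b) (2^-1 * (F z * (wt a * wt b * (z.2 0 a)^-1 * (z.2 0 b)^-1 -
    (wt b * (z.2 0 b)^-1 ^+ 2) *+ (a == b)))).
Proof.
move=> Uz; apply/matrixP => a b; rewrite !mxE; congr (_ * _); rewrite /dxdot.
rewrite (derive_eq_on _ open_positive_quadrant Uz (dxdot_kropina b)).
rewrite (@derive_val _ _ _ _ _ _ _ (is_derive_dxdot_kropina b _ Uz)).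
by congr (_ * _); elim/ord2_ind: a; elim/ord2_ind: b;
  rewrite sum2E !mxE/= ?mulr0n ?mulr1n; ring.
Qed.

Lemma kropina_lorentzian z : U z -> lorentzian (L_metric F z).
Proof.
move=> Uz; rewrite (L_metric_kropina Uz).
have F0 := kropina_gt0 Uz; have Fn0 : F z != 0 by rewrite gt_eqF.
have y0 i : z.2 0 i != 0 by rewrite gt_eqF.
(* The rows of the frame below are multiples of (0, y1) and (y0, - y1). These are orthogonal with
   squared lengths 3 L / 8 and - L / 2; [s] and [t] normalise them. *)
pose s := Num.sqrt (8 / (3 * F z)); pose t := Num.sqrt (2 / F z).
have s0 : 0 < s by rewrite sqrtr_gt0 divr_gt0// mulr_gt0.
have t0 : 0 < t by rewrite sqrtr_gt0 divr_gt0.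
have sE : s * s = 8 / (3 * F z).
  by rewrite -expr2 sqr_sqrtr// ltW// divr_gt0// mulr_gt0.
have tE : t * t = 2 / F z by rewrite -expr2 sqr_sqrtr// ltW// divr_gt0.
exists (\matrix_(i, j) if i == 0 then if j == 0 then 0 else z.2 0 1 * s
                       else if j == 0 then z.2 0 0 * t else - (z.2 0 1 * t)).
  rewrite unitmxE unitfE det_mx22 !mxE/= mul0r sub0r oppr_eq0.
  by rewrite !mulf_neq0// gt_eqF.
apply/matrixP => i j; elim/ord2_ind: i; elim/ord2_ind: j;
  rewrite !mxE sum2E !mxE !sum2E !mxE/= /kropina_weight/= ?mulr0n ?mulr1n.
- transitivity (3 / 8 * F z * (s * s)); first by field; rewrite !y0.
  by rewrite sE; field.
- by field; rewrite !y0.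
- by field; rewrite !y0.
- transitivity (- 2^-1 * F z * (t * t)); first by field; rewrite !y0.
  by rewrite tE; field.
Qed.

Lemma lorentzian_unitmx n (g : 'M[R]_n) : lorentzian g -> g \in unitmx.
Proof.
case=> P Pu gE; have : P *m g *m P^T \in unitmx.
  rewrite gE unitmxE det_diag unitfE.
  apply/prodf_neq0 => i _; rewrite mxE.
  by case: ifP => _; rewrite ?oppr_eq0 oner_eq0.
by rewrite !unitmx_mul => /andP[/andP[]].
Qed.

(** Half of Gamma^a_aa, that is (d_a f) / (2 [wt a]). *)
Definition spray_factor (a : 'I_2) z : R :=
  if a == 0 then z.1 0 1 else 3^-1 * z.1 0 0.

Definition kropina_spray (a : 'I_2) z : R := spray_factor a z * z.2 0 a ^+ 2.

(** The candidate 4 G is checked in the linear system with matrix [L_metric F z], so the inverse is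
    never computed. *)
Lemma spray_kropina a z : U z -> spray F a z = kropina_spray a z.
Proof.
move=> Uz; have y0 i : z.2 0 i != 0 by rewrite gt_eqF.
have gu := lorentzian_unitmx (kropina_lorentzian Uz).
pose S := \col_a (4 * kropina_spray a z).
suff /(congr1 (mulmx (invmx (L_metric F z)))) : L_metric F z *m S =
    \col_q (\sum_(m < 2) z.2 0 m * dx m (dxdot q F) z - dx q F z).
  rewrite mulKmx// => /colP/(_ a); rewrite !mxE => SE.
  rewrite /spray -[RHS](mulKf (x := 4))// SE; congr (_ * _).
  by apply: eq_bigr => q _; rewrite [in RHS]mxE.
rewrite L_metric_kropina//; apply/colP => q.
rewrite !mxE !sum2E !mxE !dx_dxdot_kropina// dx_kropina//.
rewrite /kropina_spray /spray_factor /kropina_weight /swap_coord.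
by elim/ord2_ind: q => /=; rewrite ?mulr0n ?mulr1n; field; rewrite !y0.
Qed.

(** * The Finsler spacetime and its induced connection *)

Definition kropina_domain : set (tangent plane) :=
  [set t : tangent plane | U (tbase t, tcomp t)].

Definition kropina (t : tangent plane) : R := F (tbase t, tcomp t).

Lemma tset_kropina (i : chart_index plane) : tset kropina_domain i = U.
Proof. by rewrite tset_euclidean; apply/seteqP; split=> -[]. Qed.

Lemma kropina_tvec (i : chart_index plane) : kropina \o tvec i = F.
Proof. by apply/funext => -[x y]; rewrite /= tvec_euclidean. Qed.

(** [spray_factor a] is linear; its derivative vanishes in fibre directions, where [w.1] is 0. *)
Lemma is_derive_spray_factor a z w :
  is_derive z w (spray_factor a) (spray_factor a w).
Proof.
apply: is_derive_affine_line => h; rewrite /spray_factor /= !mxE.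
by case: ifP => _ //; ring.
Qed.

Lemma dxdot_kropina_spray a b z :
  dxdot b (kropina_spray a) z = spray_factor a z * ((2 *+ (a == b)) * z.2 0 a).
Proof.
have dG := is_derive_mul (is_derive_spray_factor a z (0, delta_mx 0 b))
  (is_derive_pow 2 (is_derive_snd_coord z (0, delta_mx 0 b) a)).
rewrite /dxdot (@derive_val _ _ _ _ _ _ _ dG) /spray_factor /= !mxE !eqxx.
by case: (a == b); case: ifP => _; rewrite ?mulr0n ?mulr1n/=; ring.
Qed.

Lemma dxdot_dxdot_kropina_spray a b c z :
  dxdot b (dxdot c (kropina_spray a)) z =
  spray_factor a z * (2 *+ ((a == b) && (a == c))).
Proof.
have -> : dxdot c (kropina_spray a) =
    fun z => spray_factor a z * ((2 *+ (a == c)) * z.2 0 a).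
  by apply/funext => y; exact: dxdot_kropina_spray.
have dG := is_derive_mul (is_derive_spray_factor a z (0, delta_mx 0 b))
  (is_derive_mul (is_derive_cst (2 *+ (a == c) : R) z (0, delta_mx 0 b))
     (is_derive_snd_coord z (0, delta_mx 0 b) a)).
rewrite /dxdot (@derive_val _ _ _ _ _ _ _ dG) /spray_factor /= !mxE !eqxx.
by case: (a == b); case: (a == c); case: ifP => _;
  rewrite ?mulr0n ?mulr1n/=; ring.
Qed.

Lemma plane_connectionE a b c z : plane_connection z.1 a b c =
  spray_factor a z * (2 *+ ((a == b) && (a == c))).
Proof.
rewrite /plane_connection /spray_factor; case: ifP => _; last by rewrite mulr0.
by rewrite mulr1n; case: ifP => _; field.
Qed.

Lemma dxdot_dxdot_spray_kropina a b c z : U z ->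
  dxdot b (dxdot c (spray F a)) z = plane_connection z.1 a b c.
Proof.
move=> Uz; rewrite plane_connectionE -dxdot_dxdot_kropina_spray.
(* The cone is open, so the equality of sprays on it may be differentiated twice. *)
apply: derive_eq_on open_positive_quadrant Uz _ => y Uy.
by apply: derive_eq_on open_positive_quadrant Uy _ => x; exact: spray_kropina.
Qed.

Lemma kropina_induced_connection :
  induced_connection kropina_domain kropina (fun=> plane_connection).
Proof.
move=> i z; rewrite tset_kropina kropina_tvec => Uz a; split; last first.
  by move=> b c; rewrite dxdot_dxdot_spray_kropina.
rewrite spray_kropina// !sum2E !plane_connectionE /kropina_spray.
by elim/ord2_ind: a; rewrite /= ?mulr0n ?mulr1n; field.
Qed.

(** The vector (1, 1) lies in the cone over every [x], so the second derivatives of the spray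
    determine the coefficients everywhere. *)
Lemma kropina_induced_connection_unique Gamma :
  induced_connection kropina_domain kropina Gamma ->
  Gamma = fun=> plane_connection.
Proof.
move=> GammaP; apply/funext => i; apply/funext => x.
do 3!apply/funext => ?; have := GammaP i (x, const_mx 1).
rewrite tset_kropina kropina_tvec.
have Ux : U (x, const_mx 1) by move=> j; rewrite mxE.
by move=> /(_ Ux) GammaE; rewrite (GammaE _).2 dxdot_dxdot_spray_kropina.
Qed.

Lemma kropina_conic : conic_subbundle kropina_domain.
Proof.
split.
- by exists (@Tangent R 2 plane 0 (const_mx 1)) => i; rewrite mxE.
- by move=> i; rewrite tset_kropina; exact: open_positive_quadrant.
- by move=> t /(_ 0) + t0; rewrite /= t0 mxE ltxx.
- apply/seteqP; split=> // p _.
  by exists (@Tangent R 2 plane p (const_mx 1)) => // i; rewrite mxE.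
- by move=> t l At l0 i; rewrite /= mxE mulr_gt0//; exact: At.
Qed.

(** L is its own extension: the cone is open, so at a boundary point some y_j is nonpositive and its
    square root is 0. *)
Lemma kropina_extends_by_zero : extends_by_zero kropina_domain kropina.
Proof.
exists kropina; split=> // i; rewrite kropina_tvec; split.
  move=> z []; rewrite tset_kropina => _.
  rewrite (interior_id _).1; last exact: open_positive_quadrant.
  move=> /existsNP[j /negP]; rewrite -leNgt => zj.
  rewrite -[kropina _]/((kropina \o tvec i) z) kropina_tvec /kropina_fun.
  by elim/ord2_ind: j zj => /ler0_sqrtr ->; rewrite ?mul0r ?expr0n/= ?mulr0.
by apply: continuous_subspaceT; exact: kropina_continuous.
Qed.

Lemma kropina_finsler_spacetime : finsler_spacetime kropina_domain kropina.
Proof.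
split.
- exact: kropina_conic.
- by move=> i; rewrite tset_kropina kropina_tvec; exact: kropina_smooth.
- move=> t l At l0; rewrite /kropina /kropina_fun/= !mxE.
  (* Here l^(1/2) l^(3/2) = l^2 is read as an identity in the root of [l]. *)
  rewrite !sqrtrM ?ltW// -[in l ^+ 2](sqr_sqrtr (ltW l0)); ring.
- move=> i z; rewrite tset_kropina kropina_tvec => Uz.
  exact/lorentzian_unitmx/kropina_lorentzian.
(* The metric is Lorentzian and L positive on the whole cone, so it serves as its own timelike
   set. *)
exists kropina_domain; split=> //.
- exact: kropina_conic.
- by move=> t; exact: kropina_gt0.
- by move=> i z; rewrite tset_kropina kropina_tvec; exact: kropina_lorentzian.
- exact: kropina_extends_by_zero.
Qed.

End kropina_plane.

Theorem mainTheorem3 (R : realType) :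
  exists (n : nat) (M : smoothManifold R n)
         (A : set (tangent M)) (L : tangent M -> R),
    [/\ finsler_spacetime A L,
        berwald_type A L
      & forall Gamma : connection_coeffs M,
          induced_connection A L Gamma ->
          ~ ricci_symmetric Gamma /\
          ~ (exists g : M -> 'M[R]_n,
               pseudo_riemannian g /\ levi_civita_of g Gamma)].
Proof.
exists 2%N, (@euclidean_manifold R 2), kropina_domain, kropina; split.
- exact: kropina_finsler_spacetime.
- by exists (fun=> plane_connection); exact: kropina_induced_connection.
- move=> Gamma /kropina_induced_connection_unique ->.
  split; first exact: ricci_plane_connection_not_symmetric.
  by move=> [g [/plane_connection_not_levi_civita]].
Qed.
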